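(* Let $(\mathcal{A},Q)$ be an almost commutative $Q$-algebra of degree $1$ (with respect to an abelian group $G$ and cocycle $\rho$), and let $[\![-,-]\!]_Q$ denote the corresponding derived $\rho$-antibracket on $\mathrm{Sec}(\mathcal{A})$. Then for all homogeneous $\sigma,\psi,\omega\in\mathrm{Sec}(\mathcal{A})$: \begin{enumerate} \item $\big|[\![\sigma,\psi]\!]_Q\big| = |\sigma|+|\psi|+|Q|$; \item $[\![\sigma,\psi]\!]_Q = -\rho(|\sigma|+|Q|,\,|\psi|+|Q|)\,[\![\psi,\sigma]\!]_Q$; \item $[\![\sigma,[\![\psi,\omega]\!]_Q]\!]_Q = [\![[\![\sigma,\psi]\!]_Q,\omega]\!]_Q + \rho(|\sigma|+|Q|,\,|\psi|+|Q|)\,[\![\psi,[\![\sigma,\omega]\!]_Q]\!]_Q$. \end{enumerate} In short, $\mathrm{Sec}(\mathcal{A})$ equipped with the derived $\rho$-antibracket is a $\rho$-Lie antialgebra (of $G$-degree $|Q|$).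
   Context: Let $\mathbb{K}=\mathbb{R}$ or $\mathbb{C}$ and let $G$ be an abelian group written additively. A cocycle is a map $\rho:G\times G\to\mathbb{K}$ with $\rho(a,b)=\rho(b,a)^{-1}$ and $\rho(a+b,c)=\rho(a,c)\rho(b,c)$ for all $a,b,c\in G$. For a $G$-graded associative $\mathbb{K}$-algebra, $|f|\in G$ denotes the degree of a homogeneous element $f$ and the $\rho$-commutator is $[f,g]_\rho := fg-\rho(|f|,|g|)\,gf$ (extended linearly; all formulas are for homogeneous elements and extended by linearity). The algebra is $\rho$-commutative (almost commutative) if $[f,g]_\rho=0$ for all $f,g$. The same formula defines the $\rho$-commutator of homogeneous linear maps. The zero element is regarded as homogeneous of any degree. An almost commutative non-negatively graded algebra is an $(\mathbb{N},G)$-bigraded algebra $\mathcal{A}=\bigoplus_{i\in\mathbb{N},a\in G}\mathcal{A}_{(i,a)}$ (with $\mathcal{A}_{(i,a)}\cdot\mathcal{A}_{(j,b)}\subset\mathcal{A}_{(i+j,a+b)}$, $0\in\mathbb{N}$) that is $\rho$-commutative with respect to the $G$-degree; the $\mathbb{N}$-degree is called weight and plays no role in the commutation rule. Put $\mathcal{A}_i:=\bigoplus_{a}\mathcal{A}_{(i,a)}$, let $\mathrm{Alg}(\mathcal{A}_i)$ be the subalgebra generated by $\mathcal{A}_0\oplus\cdots\oplus\mathcal{A}_i$, and $\mathcal{A}_{\langle i\rangle}:=\mathrm{Alg}(\mathcal{A}_{i-1})\cap\mathcal{A}_i$. $\mathcal{A}$ is of degree $n$ if $\mathcal{A}_i/\mathcal{A}_{\langle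 i\rangle}=\{0\}$ for all $i>n$ (by convention $n$ is the least such integer). A $\rho$-derivation of $\mathcal{A}$ of $G$-degree $|X|$ is a linear map $X:\mathcal{A}\to\mathcal{A}$ of $G$-degree $|X|$ with $X(fg)=(Xf)g+\rho(|X|,|f|)\,f(Xg)$. $\rho\mathrm{Der}(\mathcal{A})$ is the $G$-graded vector space of all $\rho$-derivations; it is closed under $[-,-]_\rho$. It is also $\mathbb{Z}$-graded by weight: $\rho\mathrm{Der}_i(\mathcal{A})$ consists of the $\rho$-derivations that shift weight by $i$. A homological $\rho$-derivation is a homogeneous $Q\in\rho\mathrm{Der}(\mathcal{A})$ with $\rho(|Q|,|Q|)=-1$ and $[Q,Q]_\rho=0$. An almost commutative $Q$-algebra of degree $1$ is a pair $(\mathcal{A},Q)$ with $\mathcal{A}$ an almost commutative non-negatively graded algebra of degree one and $Q$ a homological $\rho$-derivation of $\mathcal{A}$ of weight ($\mathbb{Z}$-degree) $1$. Its sections are $\mathrm{Sec}(\mathcal{A}):=\rho\mathrm{Der}_-(\mathcal{A})$, the $\rho$-derivations of negative weight (which here all have weight $-1$), graded by $G$-degree. The derived $\rho$-antibracket is the bilinear map $\mathrm{Sec}(\mathcal{A})\times\mathrm{Sec}(\mathcal{A})\to\mathrm{Sec}(\mathcal{A})$, $$[\![\sigma,\psi]\!]_Q:=\rho(|\sigma|+|Q|,|Q|)\,[[Q,\sigma]_\rho,\psi]_\rho .$$ A $\rho$-Lie antialgebra of $G$-degree $|\mathfrak{g}|\in G$ is a $G$-graded vector space $\mathfrak{g}$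 with a bilinear map $[-,-]_{\mathfrak g}:\mathfrak g\times\mathfrak g\to\mathfrak g$ such that $\rho(|\mathfrak g|,|\mathfrak g|)=-1$; $|[f,g]_{\mathfrak g}|=|\mathfrak g|+|f|+|g|$; $[f,[g,h]_{\mathfrak g}]_{\mathfrak g}=[[f,g]_{\mathfrak g},h]_{\mathfrak g}+\rho(|f|+|\mathfrak g|,|g|+|\mathfrak g|)[g,[f,h]_{\mathfrak g}]_{\mathfrak g}$; and $[f,g]_{\mathfrak g}=-\rho(|f|+|\mathfrak g|,|g|+|\mathfrak g|)[g,f]_{\mathfrak g}$, for all homogeneous $f,g,h\in\mathfrak g$. *)

(* Defs.v *)
From HB Require Import structures.
From mathcomp Require Import all_boot all_order all_algebra.
From mathcomp Require Import all_classical reals.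
From mathcomp.real_closed Require Import complex.

Set Implicit Arguments.
Unset Strict Implicit.
Unset Printing Implicit Defensive.

Import Order.TTheory GRing.Theory Num.Theory.

Local Open Scope classical_set_scope.
Local Open Scope ring_scope.

Variant scalar_choice := RealScalars | ComplexScalars.

Definition scalars (R : realType) (c : scalar_choice) : numFieldType :=
  match c with
  | RealScalars => R
  | ComplexScalars => complex R
  end.

Section GradedSpaces.
Context {K : numFieldType} {E : lmodType K}.

Definition subspace (S : set E) : Prop :=
  S 0 /\ forall (k : K) x y, S x -> S y -> S (k *: x + y).

Context {I : choiceType}.
Implicit Type V : I -> set E.

(* The finiteness clause is essential: a sum over [set: I] with infinite
   support is 0 by convention. *)
Definition decomposes V (x : E) (f : I -> E) : Prop :=
  [/\ forall i, V i (f i),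
      finite_set [set i | f i != 0]
    & x = \sum_(i \in [set: I]) f i].

Definition sum_of V : set E := [set x | exists f, decomposes V x f].

Definition graded V : Prop :=
  (forall i, subspace (V i)) /\
  (forall x f g, decomposes V x f -> decomposes V x g -> f = g).

Definition component V (i : I) (x : E) : E :=
  xget (fun=> 0) [set f | decomposes V x f] i.

End GradedSpaces.

(* Since 0^-1 = 0, nonvanishing has to be required explicitly: otherwise the
   zero map would satisfy the two equations. *)
Record cocycle (K : numFieldType) (G : zmodType) (rho : G -> G -> K) : Prop :=
  Cocycle {
    cocycle_neq0 : forall a b, rho a b != 0;
    cocycle_anti : forall a b, rho a b = (rho b a)^-1;
    cocycle_addl : forall a b c, rho (a + b) c = rho a c * rho b c }.

(* [x, y]_rho for a G-grading V and a product mul: the formula on homogeneous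
   elements, extended bilinearly through homogeneous components. *)
Definition rho_commutator {K : numFieldType} {G : zmodType}
    (rho : G -> G -> K) {E : lmodType K} (V : G -> set E)
    (mul : E -> E -> E) (x y : E) : E :=
  \sum_(a \in [set: G]) \sum_(b \in [set: G])
    (mul (component V a x) (component V b y)
     - rho a b *: mul (component V b y) (component V a x)).

(* Almost commutative non-negatively graded algebras, not assumed unital. *)
Record acAlgebra (K : numFieldType) (G : zmodType) (rho : G -> G -> K) :=
  AcAlgebra {
    ac_sort :> lmodType K;
    ac_mul : {bilinear ac_sort -> ac_sort -> ac_sort};
    ac_part : nat -> G -> set ac_sort;
    ac_mulA : associative ac_mul;
    ac_graded : graded (fun p : nat * G => ac_part p.1 p.2);
    ac_exhaustive : sum_of (fun p : nat * G => ac_part p.1 p.2) = [set: ac_sort];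
    ac_mul_part : forall i a j b x y,
      ac_part i a x -> ac_part j b y -> ac_part (i + j)%N (a + b) (ac_mul x y);
    ac_commutative : forall x y : ac_sort,
      rho_commutator rho (fun a => sum_of (fun i => ac_part i a)) ac_mul x y = 0
  }.

Arguments ac_part {K G rho} A i a : rename.
Arguments ac_mul {K G rho} A : rename.

Section Derivations.
Context {K : numFieldType} {G : zmodType} {rho : G -> G -> K}.
Variable A : acAlgebra rho.

Definition Gpart (a : G) : set A := sum_of (fun i => ac_part A i a).

Definition weight_part (i : nat) : set A := sum_of (fun a => ac_part A i a).

Definition weight_partZ (w : int) : set A :=
  match w with
  | Posz i => weight_part i
  | Negz _ => [set 0]
  end.

Definition subalgebra (B : set A) : Prop :=
  subspace B /\ forall x y, B x -> B y -> B (ac_mul A x y).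

Definition Alg (i : nat) : set A :=
  smallest subalgebra (\bigcup_(j in [set j | (j <= i)%N]) weight_part j).

(* Only meaningful, and only used, for i >= 1. *)
Definition decomposable_part (i : nat) : set A := Alg i.-1 `&` weight_part i.

(* A_i / A_<i> = 0 amounts to A_i = A_<i>. *)
Definition generated_by_weight (n : nat) : Prop :=
  forall i, (n < i)%N -> weight_part i = decomposable_part i.

Definition has_degree (n : nat) : Prop :=
  generated_by_weight n /\ forall m, generated_by_weight m -> (n <= m)%N.

Definition Hom_part (a : G) : set (A -> A) :=
  [set X | linear X /\ forall b x, Gpart b x -> Gpart (a + b) (X x)].

Definition endo_commutator (X Y : A -> A) : A -> A :=
  rho_commutator rho Hom_part (fun X' Y' : A -> A => X' \o Y') X Y.

Definition rhoDer (a : G) : set (A -> A) :=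
  [set X | Hom_part a X /\
     forall b f g, Gpart b f ->
       X (ac_mul A f g) = ac_mul A (X f) g + rho a b *: ac_mul A f (X g)].

Definition rhoDer_weight (w : int) (a : G) : set (A -> A) :=
  [set X | rhoDer a X /\
     forall i f, weight_part i f -> weight_partZ (w + i%:Z) (X f)].

(* Negz n is the weight -(n + 1). *)
Definition Sec (a : G) : set (A -> A) :=
  sum_of (fun n : nat => rhoDer_weight (Negz n) a).

Definition homological (q : G) (Q : A -> A) : Prop :=
  [/\ rhoDer q Q, rho q q = -1 & endo_commutator Q Q = 0].

Definition Qalgebra_degree1 (q : G) (Q : A -> A) : Prop :=
  [/\ has_degree 1, homological q Q & rhoDer_weight 1 q Q].

(* The sign depends on |sigma|, hence the sum over homogeneous components. *)
Definition derived_antibracket (q : G) (Q sigma psi : A -> A) : A -> A :=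
  \sum_(a \in [set: G]) rho (a + q) q *:
    endo_commutator (endo_commutator Q (component Sec a sigma)) psi.

End Derivations.

(* The graded space is the (internal) direct sum of the L a inside E. *)
Record rho_Lie_antialgebra (K : numFieldType) (G : zmodType)
    (rho : G -> G -> K) (E : lmodType K) (g : G) (L : G -> set E)
    (br : E -> E -> E) : Prop := RhoLieAntialgebra {
  antialg_graded : graded L;
  antialg_linearl : forall (k : K) x x' y,
    sum_of L x -> sum_of L x' -> sum_of L y ->
    br (k *: x + x') y = k *: br x y + br x' y;
  antialg_linearr : forall (k : K) x y y',
    sum_of L x -> sum_of L y -> sum_of L y' ->
    br x (k *: y + y') = k *: br x y + br x y';
  antialg_closed : forall x y, sum_of L x -> sum_of L y -> sum_of L (br x y);
  antialg_odd : rho g g = -1;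
  antialg_degree : forall a b x y, L a x -> L b y -> L (g + a + b) (br x y);
  antialg_jacobi : forall a b c x y z, L a x -> L b y -> L c z ->
    br x (br y z) = br (br x y) z + rho (a + g) (b + g) *: br y (br x z);
  antialg_anti : forall a b x y, L a x -> L b y ->
    br x y = - (rho (a + g) (b + g) *: br y x) }.

(* Main.v *)
Require Import Defs.
From HB Require Import structures.
From mathcomp Require Import all_boot all_order all_algebra.
From mathcomp Require Import finmap all_classical reals.

Set Implicit Arguments.
Unset Strict Implicit.
Unset Printing Implicit Defensive.

Import Order.TTheory GRing.Theory Num.Theory.

Local Open Scope classical_set_scope.
Local Open Scope ring_scope.

(** The antibracket is a derived bracket in the sense of Kosmann-Schwarzbach:
    up to a scalar it is [[Q, sigma], psi], where brackets are rho-commutators.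
    Everything follows from three facts about rho-commutators of homogeneous
    linear maps.

    Jacobi and antisymmetry ([endo_commutator_jacobi],
    [endo_commutator_antisym]): they hold for all homogeneous linear maps, as
    identities between words in three maps.

    Sections commute ([Sec_commute]): a derivation is determined by its values on
    generators, which for an algebra of degree 1 have weight 0 or 1.  A derivation
    of weight below -1 sends them to negative weights, hence vanishes.  So every
    section has weight -1, and the commutator of two sections, of weight -2, is
    zero.

    [Q, -] is a differential ([homological_differential]): Jacobi gives
    2 [Q, [Q, X]] = [[Q, Q], X] = 0.

    Expanding [Q, [sigma, psi]] = 0 by Jacobi compares [[Q, sigma], psi] with
    [[Q, psi], sigma], which is the antisymmetry of the antibracket.  Expanding
    [Q, [[Q, sigma], psi]] by Jacobi gives a multiple of
    [[Q, sigma], [Q, psi]]: the map sending sigma to [Q, sigma] takes antibrackets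
    to commutators, and the Jacobi identity of the antibracket is the one of
    [Q, sigma], [Q, psi] and omega.  The remaining work is bookkeeping of the
    factors rho, using rho(q, q) = -1.

    The commutator and the antibracket are defined on all maps by decomposing
    them into homogeneous components, so these components have to be well
    behaved: the homogeneous linear maps of the various degrees must be linearly
    independent.  This is inherited from the bigrading of the algebra, first by
    the grading by G ([Gpart_graded]) and then by linear maps
    ([Hom_part_graded]).  Components are then linear, and the antibracket is
    bilinear on sums of homogeneous sections. *)

(** * Graded vector spaces *)

Section LinearMaps.
Context {K : numFieldType} {E E' : lmodType K}.
Implicit Types (X : E -> E') (k : K) (f g : E).

Lemma linear_eq0 X : linear X -> X 0 = 0.
Proof.
by move=> lin; have := lin (-1) 0 0; rewrite scaler0 addr0 scaleN1r addNr.
Qed.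

Lemma linear_eqD X f g : linear X -> X (f + g) = X f + X g.
Proof. by move=> lin; have := lin 1 f g; rewrite !scale1r. Qed.

Lemma linear_eqZ X k f : linear X -> X (k *: f) = k *: X f.
Proof. by move=> lin; have := lin k f 0; rewrite (linear_eq0 lin) !addr0. Qed.

Lemma linear_eqB X f g : linear X -> X (f - g) = X f - X g.
Proof.
by move=> lin; rewrite (linear_eqD _ _ lin) -scaleN1r (linear_eqZ _ _ lin) scaleN1r.
Qed.

Lemma kernel_subspace X : linear X -> subspace [set f | X f = 0].
Proof.
move=> lin; split=> [|k x y /= x0 y0]; first exact: linear_eq0.
by rewrite lin x0 y0 scaler0 addr0.
Qed.

End LinearMaps.

Section FiniteSupportSums.
Context {K : numFieldType} {I : choiceType}.
Implicit Types E : lmodType K.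

Lemma fsum_linear E (k : K) (F F' : I -> E) :
    finite_set [set i | F i != 0] -> finite_set [set i | F' i != 0] ->
  \sum_(i \in [set: I]) (k *: F i + F' i) =
    k *: (\sum_(i \in [set: I]) F i) + \sum_(i \in [set: I]) F' i.
Proof.
move=> finF finF'.
have fin : finite_set ([set i | F i != 0] `|` [set i | F' i != 0]).
  by rewrite finite_setU.
have outside i : i \notin fset_set ([set i | F i != 0] `|` [set i | F' i != 0]) ->
    F i = 0 /\ F' i = 0.
  rewrite in_fset_set// notin_setE => /not_orP[/=].
  by move=> /negP/negPn/eqP -> /negP/negPn/eqP ->.
rewrite !(fsbigTE (fset_set ([set i | F i != 0] `|` [set i | F' i != 0]))).
- by rewrite big_split/= scaler_sumr.
- by move=> i /outside[].
- by move=> i /outside[].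
- by move=> i /outside[-> ->]; rewrite scaler0 addr0.
Qed.

Lemma fsum_image E E' (f : E -> E') (F : I -> E) : linear f ->
    finite_set [set i | F i != 0] ->
  f (\sum_(i \in [set: I]) F i) = \sum_(i \in [set: I]) f (F i).
Proof.
move=> linf finF.
rewrite !(fsbigTE (fset_set [set i | F i != 0])); last 2 first.
- move=> i; rewrite in_fset_set// notin_setE/= => /negP/negPn/eqP ->; exact: linear_eq0.
- by move=> i; rewrite in_fset_set// notin_setE => /negP/negPn/eqP.
apply: (big_morph f _ (linear_eq0 linf)) => x y; exact: linear_eqD.
Qed.

Lemma fsum_single (E : zmodType) (F : I -> E) (i0 : I) :
  (forall i, i != i0 -> F i = 0) -> \sum_(i \in [set: I]) F i = F i0.
Proof.
move=> F0; have <- : \sum_(i \in [set i0]) F i = F i0 by exact: fsbig_set1.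
apply/esym/fsbig_widen => // i.
by move=> [_ /= ii0]; apply: F0; apply/eqP.
Qed.

End FiniteSupportSums.

Section GradedSpaces.
Context {K : numFieldType} {E : lmodType K}.
Implicit Types (S P : set E) (x y : E).

Lemma subspaceZ S (k : K) x : subspace S -> S x -> S (k *: x).
Proof. by move=> [S0 SP] Sx; rewrite -[k *: x]addr0; apply: SP. Qed.

Lemma subspaceD S x y : subspace S -> S x -> S y -> S (x + y).
Proof. by move=> [S0 SP] Sx Sy; rewrite -[x]scale1r; apply: SP. Qed.

Lemma subspaceN S x : subspace S -> S x -> S (- x).
Proof. by move=> SS Sx; rewrite -scaleN1r; apply: subspaceZ. Qed.

Lemma subspace_fsum (I : choiceType) S (F : I -> E) : subspace S ->
  (forall i, S (F i)) -> S (\sum_(i \in [set: I]) F i).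
Proof.
move=> SS SF; apply: (big_ind S) => //; first by case: SS.
by move=> x y; apply: subspaceD.
Qed.

Context {I : choiceType}.
Implicit Types (V W : I -> set E) (f g : I -> E).

Lemma decomposes_linear V (k : K) x y f g : (forall i, subspace (V i)) ->
    decomposes V x f -> decomposes V y g ->
  decomposes V (k *: x + y) (fun i => k *: f i + g i).
Proof.
move=> SV [Vf finf ->] [Vg fing ->]; split.
- by move=> i; case: (SV i) => _; apply.
- apply: (@sub_finite_set _ _ ([set i | f i != 0] `|` [set i | g i != 0])).
    move=> i /=; have [->|] := eqVneq (f i) 0; last by left.
    by rewrite scaler0 add0r; right.
  by rewrite finite_setU.
- by rewrite fsum_linear.
Qed.

Lemma decomposes_single V (i0 : I) x : (forall i, subspace (V i)) ->
  V i0 x -> decomposes V x (fun i => if i == i0 then x else 0).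
Proof.
move=> SV Vx; split.
- by move=> i; case: eqP => [->//|_]; case: (SV i).
- apply: (@sub_finite_set _ _ [set i0]) => [i /=|]; last exact: finite_set1.
  by have [->//|_] := eqVneq i i0; rewrite eqxx.
- by rewrite (fsum_single (i0 := i0)) ?eqxx// => i /negPf ->.
Qed.

Lemma sum_of_mem V (i : I) x : (forall i, subspace (V i)) ->
  V i x -> sum_of V x.
Proof. by move=> SV Vx; eexists; apply: (decomposes_single SV Vx). Qed.

Lemma sum_of_subspace V : (forall i, subspace (V i)) -> subspace (sum_of V).
Proof.
move=> SV; split.
  exists (fun=> 0); split; first by move=> i; case: (SV i).
    by apply: (@sub_finite_set _ _ set0) => // i /=; rewrite eqxx.
  by rewrite fsbig1.
move=> k x y [f Vf] [g Vg]; exists (fun i => k *: f i + g i).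
exact: decomposes_linear.
Qed.

(** The sum of a family is the least subspace containing it: this is the
    induction principle by which every statement about sums of homogeneous
    elements is reduced to homogeneous ones. *)
Lemma sum_of_min V S : subspace S -> (forall i, V i `<=` S) -> sum_of V `<=` S.
Proof.
by move=> SS VS x [f [Vf _ ->]]; apply: subspace_fsum => // i; apply/VS/Vf.
Qed.

Lemma component_decomposes V x f (i : I) : graded V -> decomposes V x f ->
  component V i x = f i.
Proof.
move=> [_ uniq] Vf; rewrite /component; case: xgetP => [g _ Vg|].
  by rewrite (uniq _ _ _ Vg Vf).
by move=> /(_ f).
Qed.

Lemma component_homogeneous V (i j : I) x : graded V -> V i x ->
  component V j x = if j == i then x else 0.
Proof.
move=> gV Vx.
by rewrite (component_decomposes j gV (decomposes_single gV.1 Vx)).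
Qed.

Lemma component_mem V (i : I) x : graded V -> V i (component V i x).
Proof.
move=> gV; rewrite /component; case: xgetP => [f _ [+ _ _]|_]; first exact.
by case: (gV.1 i).
Qed.

Lemma sum_of_decomposes V x : graded V -> sum_of V x ->
  decomposes V x (fun i => component V i x).
Proof.
move=> gV [f Vf]; suff -> : (fun i => component V i x) = f by [].
by apply/funext => i; apply: component_decomposes.
Qed.

Lemma component_linear V (i : I) (k : K) x y : graded V ->
    sum_of V x -> sum_of V y ->
  component V i (k *: x + y) = k *: component V i x + component V i y.
Proof.
move=> gV /(sum_of_decomposes gV) Vx /(sum_of_decomposes gV) Vy.
exact: component_decomposes (decomposes_linear k gV.1 Vx Vy).
Qed.

(** Uniqueness of decompositions follows from linear maps [p i t] that kill the
    pieces [V j] with [j != i] and are jointly injective on [V i]: applied to a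
    relation between homogeneous elements, they isolate each of its terms. *)
Lemma graded_by_detection V (T : Type) (E' : lmodType K)
    (p : I -> T -> E -> E') :
    (forall i, subspace (V i)) -> (forall i t, linear (p i t)) ->
    (forall i j t x, j != i -> V j x -> p i t x = 0) ->
    (forall i x, V i x -> (forall t, p i t x = 0) -> x = 0) ->
  graded V.
Proof.
move=> SV linp p_out p_inj; split=> // x f g Vf Vg.
have {Vf Vg} := decomposes_linear (-1) SV Vf Vg.
rewrite scaleN1r addNr; set h := fun i => _ => -[Vh finh sumh].
suff h0 i : h i = 0.
  apply/funext => i; apply/esym/subr0_eq.
  by rewrite -(h0 i) /h scaleN1r addrC.
apply: (p_inj i) => // t; have := fsum_image (linp i t) finh.
rewrite -sumh (fsum_single (i0 := i)) => [<-|j ji]; last exact: p_out ji (Vh j).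
exact: linear_eq0.
Qed.

Lemma graded_sub V W : graded V -> (forall i, subspace (W i)) ->
  (forall i, W i `<=` V i) -> graded W.
Proof.
move=> [_ uniq] SW WV; split=> // x f g [Wf finf xf] [Wg fing xg].
by apply: (uniq x); split=> // i; apply: WV.
Qed.

(** The convention that formulas given on homogeneous elements are extended by
    linearity. *)
Definition homogeneous_extension {E' : lmodType K} V (F : I -> E -> E') x : E' :=
  \sum_(i \in [set: I]) F i (component V i x).

Lemma homogeneous_extensionE (E' : lmodType K) V (F : I -> E -> E') (i : I) x :
    graded V -> (forall j, F j 0 = 0) -> V i x ->
  homogeneous_extension V F x = F i x.
Proof.
move=> gV F0 Vx; rewrite /homogeneous_extension (fsum_single (i0 := i)).
  by rewrite (component_homogeneous i gV Vx) eqxx.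
by move=> j /negPf ji; rewrite (component_homogeneous j gV Vx) ji.
Qed.

Lemma homogeneous_extension_linear (E' : lmodType K) V (F : I -> E -> E')
    (k : K) x y : graded V ->
    (forall i l u v, V i u -> V i v -> F i (l *: u + v) = l *: F i u + F i v) ->
    sum_of V x -> sum_of V y ->
  homogeneous_extension V F (k *: x + y) =
    k *: homogeneous_extension V F x + homogeneous_extension V F y.
Proof.
move=> gV linF Vx Vy.
have F0 i : F i 0 = 0.
  have V0 : V i 0 by case: (gV.1 i).
  by have := linF i (-1) 0 0 V0 V0; rewrite scaler0 addr0 scaleN1r addNr.
have finF z : sum_of V z -> finite_set [set i | F i (component V i z) != 0].
  move=> /(sum_of_decomposes gV)[_ + _]; apply: sub_finite_set => i /=.
  by apply: contra_neq => ->.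
rewrite /homogeneous_extension -fsum_linear; [|exact: finF..].
by apply: eq_fsbigr => i _; rewrite component_linear// linF//; apply: component_mem.
Qed.

End GradedSpaces.

(** * Gradings of the algebra and of its linear maps *)

Section Cocycles.
Context {K : numFieldType} {G : zmodType} {rho : G -> G -> K}.
Context (hrho : cocycle rho).

Lemma cocycle_sym (a b : G) : rho a b * rho b a = 1.
Proof. by rewrite (cocycle_anti hrho) mulVf// cocycle_neq0. Qed.

Lemma cocycle_addr (a b c : G) : rho a (b + c) = rho a b * rho a c.
Proof.
rewrite (cocycle_anti hrho) (cocycle_addl hrho) invfM.
by rewrite -!(cocycle_anti hrho).
Qed.

End Cocycles.

Section Gradings.
Context {K : numFieldType} {G : zmodType} {rho : G -> G -> K}.
Context (A : acAlgebra rho).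
Implicit Types (a b c : G) (f g : A) (X Y Z : A -> A).

Let bipart (p : nat * G) : set A := ac_part A p.1 p.2.
Let bigraded : graded bipart := ac_graded A.

Let sum_bipart (f : A) : sum_of bipart f.
Proof. by rewrite /bipart (ac_exhaustive A). Qed.

Lemma ac_part_subspace (i : nat) a : subspace (ac_part A i a).
Proof. exact: (bigraded.1 (i, a)). Qed.

Lemma Gpart_subspace a : subspace (@Gpart _ _ _ A a).
Proof. by apply: sum_of_subspace => i; apply: ac_part_subspace. Qed.

Lemma weight_part_subspace (i : nat) : subspace (@weight_part _ _ _ A i).
Proof. by apply: sum_of_subspace => a; apply: ac_part_subspace. Qed.

Lemma weight_partZ_subspace (w : int) : subspace (@weight_partZ _ _ _ A w).
Proof.
case: w => i; first exact: weight_part_subspace.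
by split=> // k x y -> ->; rewrite scaler0 addr0.
Qed.

Lemma sum_weight_part f : sum_of (@weight_part _ _ _ A) f.
Proof.
have := sum_bipart f; apply: sum_of_min.
  by apply: sum_of_subspace => i; apply: weight_part_subspace.
move=> [i a] x Vx; apply: (sum_of_mem (i := i)).
  by move=> j; apply: weight_part_subspace.
by apply: (sum_of_mem (i := a)) => // b; apply: ac_part_subspace.
Qed.

Lemma sum_Gpart f : sum_of (@Gpart _ _ _ A) f.
Proof.
have := sum_bipart f; apply: sum_of_min.
  by apply: sum_of_subspace => a; apply: Gpart_subspace.
move=> [i a] x Vx; apply: (sum_of_mem (i := a)).
  by move=> b; apply: Gpart_subspace.
by apply: (sum_of_mem (i := i)) => // j; apply: ac_part_subspace.
Qed.

(** A homogeneous element of degree [a] is detected by its bihomogeneous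
    components in the bidegrees [(i, a)]. *)
Lemma Gpart_graded : graded (@Gpart _ _ _ A).
Proof.
have lin p : linear (component bipart p).
  by move=> k x y; apply: component_linear.
have out i a b x : b != a -> Gpart b x -> component bipart (i, a) x = 0.
  move=> ba; apply: (sum_of_min (kernel_subspace (lin (i, a)))).
  move=> j y Vy /=; rewrite (@component_homogeneous _ _ _ _ (j, b))//.
  by rewrite -pair_eqE/= (eq_sym a) (negPf ba) andbF.
apply: (graded_by_detection (p := fun a i => component bipart (i, a))) => //.
- exact: Gpart_subspace.
- by move=> a b i x; apply: out.
- move=> a x Vx x0; have [_ _ ->] := sum_of_decomposes bigraded (sum_bipart x).
  apply: fsbig1 => -[i b] _; have [->//|ba] := eqVneq b a.
  by apply: (out _ _ a) => //; rewrite eq_sym.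
Qed.

Lemma ac_homogeneous_ind (S : set A) : subspace S ->
  (forall a, Gpart a `<=` S) -> forall f, S f.
Proof. by move=> SS VS f; apply: (sum_of_min SS VS); apply: sum_Gpart. Qed.

Lemma Hom_part_subspace a : subspace (@Hom_part _ _ _ A a).
Proof.
split.
  split=> [k x y|b x _]; last by case: (Gpart_subspace (a + b)).
  by rewrite [RHS](_ : _ = k *: 0 + 0)// scaler0 addr0.
move=> k X Y [linX degX] [linY degY]; split=> [l x y|b x Vx].
  (* The operations on maps are pointwise by conversion, so that identities between
     maps are restated, here and below, by spelling out their values. *)
  rewrite [LHS](_ : _ = k *: X (l *: x + y) + Y (l *: x + y))//.
  rewrite [RHS](_ : _ = l *: (k *: X x + Y x) + (k *: X y + Y y))//.
  rewrite linX linY !scalerDr !scalerA (mulrC l) -!addrA; congr (_ + _).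
  by rewrite addrCA.
have [_ SG] := Gpart_subspace (a + b).
by apply: SG; [apply: degX | apply: degY].
Qed.

(** A linear map of degree [a] is detected by the components of degree [a + b]
    of its values at homogeneous elements of degree [b]. *)
Lemma Hom_part_graded : graded (@Hom_part _ _ _ A).
Proof.
pose T := {bf : G * A | Gpart bf.1 bf.2}.
pose p a (t : T) X : A := component (@Gpart _ _ _ A) (a + (sval t).1) (X (sval t).2).
apply: (graded_by_detection (p := p)).
- exact: Hom_part_subspace.
- move=> a t k X Y; rewrite /p [(k *: X + Y) _](_ : _ = k *: X (sval t).2 + Y (sval t).2)//.
  by apply: component_linear => //; [exact: Gpart_graded | exact: sum_Gpart..].
- move=> a b [[c f] Vf] X ba [_ /(_ c f Vf) Xf]; rewrite /p /=.
  rewrite (component_homogeneous _ Gpart_graded Xf).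
  by rewrite (inj_eq (addIr c)) eq_sym (negPf ba).
- move=> a X [linX degX] X0; apply/funext.
  apply: (ac_homogeneous_ind (kernel_subspace linX)) => b f Vf /=.
  have := X0 (exist _ (b, f) Vf); rewrite /p /=.
  by rewrite (component_homogeneous _ Gpart_graded (degX _ _ Vf)) eqxx.
Qed.

End Gradings.

(** * Rho-commutators of linear maps *)

Section Commutators.
Context {K : numFieldType} {G : zmodType} {rho : G -> G -> K}.
Context (hrho : cocycle rho).
Context (A : acAlgebra rho).
Implicit Types (a b c : G) (f g : A) (X Y Z : A -> A) (k : K).

Local Notation comm := (@endo_commutator _ _ rho A).

(** For [X] of degree [a] the commutator is the linear extension, in its second
    argument alone, of the homogeneous formula: the double sum over degrees
    collapses to a single one. *)
Lemma endo_commutator_extension a X Y : Hom_part a X ->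
  comm X Y = homogeneous_extension (@Hom_part _ _ _ A)
    (fun b Y' => X \o Y' - rho a b *: (Y' \o X)) Y.
Proof.
move=> HX; have gH := Hom_part_graded A.
rewrite /endo_commutator /rho_commutator (fsum_single (i0 := a)).
  by apply: eq_fsbigr => b _; rewrite (component_homogeneous _ gH HX) eqxx.
move=> c /negPf ca; apply: fsbig1 => b _.
rewrite (component_homogeneous _ gH HX) ca; apply/funext => f.
have [linY _] := component_mem b Y gH; set Y' := component _ _ _ in linY *.
rewrite [LHS](_ : _ = 0 - rho c b *: Y' 0)//.
by rewrite (linear_eq0 linY) scaler0 subr0.
Qed.

Lemma endo_commutatorE a b X Y : Hom_part a X -> Hom_part b Y ->
  comm X Y = X \o Y - rho a b *: (Y \o X).
Proof.
move=> HX HY; rewrite (endo_commutator_extension _ HX).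
rewrite (homogeneous_extensionE (Hom_part_graded A) _ HY)// => c.
apply/funext => f; rewrite [LHS](_ : _ = X 0 - rho a c *: 0)//.
by rewrite (linear_eq0 HX.1) scaler0 subr0.
Qed.

(** The left argument is kept homogeneous: the derived bracket is a commutator
    with a map of known degree, so one-sided linearity is enough. *)
Lemma endo_commutator_linearr a k X Y Y' : Hom_part a X ->
    sum_of (@Hom_part _ _ _ A) Y -> sum_of (@Hom_part _ _ _ A) Y' ->
  comm X (k *: Y + Y') = k *: comm X Y + comm X Y'.
Proof.
move=> HX HY HY'; rewrite !(endo_commutator_extension _ HX).
apply: homogeneous_extension_linear => // [|b l U V _ _].
  exact: Hom_part_graded.
apply/funext => f.
rewrite [LHS](_ : _ = X (l *: U f + V f) - rho a b *: (l *: U (X f) + V (X f)))//.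
rewrite [RHS](_ : _ = l *: (X (U f) - rho a b *: U (X f))
                      + (X (V f) - rho a b *: V (X f)))//.
rewrite HX.1 scalerBr scalerDr !scalerA (mulrC l) opprD !addrA.
by rewrite (ACl (1 * 3 * 2 * 4))%AC.
Qed.

Lemma endo_commutator_linearl a k X X' Y : Hom_part a X -> Hom_part a X' ->
    sum_of (@Hom_part _ _ _ A) Y ->
  comm (k *: X + X') Y = k *: comm X Y + comm X' Y.
Proof.
move=> HX HX'; have HkX : Hom_part a (k *: X + X').
  by case: (Hom_part_subspace A a) => _; apply.
move=> HY.
have fin Z : Hom_part a Z -> finite_set [set b |
    Z \o component (@Hom_part _ _ _ A) b Y
      - rho a b *: (component (@Hom_part _ _ _ A) b Y \o Z) != 0].
  have [_ + _] := sum_of_decomposes (Hom_part_graded A) HY.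
  move=> + HZ; apply: sub_finite_set => b /=; apply: contra_neq => ->.
  apply/funext => f; rewrite [LHS](_ : _ = Z 0 - rho a b *: 0)//.
  by rewrite (linear_eq0 HZ.1) scaler0 subr0.
rewrite !(@endo_commutator_extension a)// /homogeneous_extension.
rewrite -fsum_linear; [|exact: fin..].
apply: eq_fsbigr => b _; apply/funext => f.
have [linY _] := component_mem b Y (Hom_part_graded A).
set Y' := component _ _ _ in linY *.
rewrite [LHS](_ : _ = k *: X (Y' f) + X' (Y' f) - rho a b *: Y' (k *: X f + X' f))//.
rewrite [RHS](_ : _ = k *: (X (Y' f) - rho a b *: Y' (X f))
                      + (X' (Y' f) - rho a b *: Y' (X' f)))//.
rewrite linY scalerBr scalerDr !scalerA (mulrC k) opprD !addrA.
by rewrite (ACl (1 * 3 * 2 * 4))%AC.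
Qed.

Lemma endo_commutator0r a X : Hom_part a X -> comm X 0 = 0.
Proof.
move=> HX; have H0 : Hom_part a (0 : A -> A) by case: (Hom_part_subspace A a).
rewrite (endo_commutatorE HX H0); apply/funext => f.
rewrite [LHS](_ : _ = X 0 - rho a a *: 0)//.
by rewrite (linear_eq0 HX.1) scaler0 subr0.
Qed.

Lemma endo_commutator0l Y : comm 0 Y = 0.
Proof.
have H0 : Hom_part 0 (0 : A -> A) by case: (Hom_part_subspace A 0).
rewrite (endo_commutator_extension _ H0); apply: fsbig1 => b _.
have [linY _] := component_mem b Y (Hom_part_graded A).
set Y' := component _ _ _ in linY *; apply/funext => f.
rewrite [LHS](_ : _ = 0 - rho 0 b *: Y' 0)//.
by rewrite (linear_eq0 linY) scaler0 subr0.
Qed.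

Lemma endo_commutatorZr a b k X Y : Hom_part a X -> Hom_part b Y ->
  comm X (k *: Y) = k *: comm X Y.
Proof.
move=> HX HY; have SH := @Hom_part_subspace _ _ _ A; rewrite -[k *: Y]addr0.
rewrite (endo_commutator_linearr _ HX) ?(endo_commutator0r HX) ?addr0//.
- exact: sum_of_mem SH HY.
- by apply: (sum_of_mem (i := b)) => //; case: (SH b).
Qed.

Lemma endo_commutatorZl a b k X Y : Hom_part a X -> Hom_part b Y ->
  comm (k *: X) Y = k *: comm X Y.
Proof.
move=> HX HY; have SH := @Hom_part_subspace _ _ _ A; rewrite -[k *: X]addr0.
rewrite (endo_commutator_linearl _ HX) ?endo_commutator0l ?addr0//.
- by case: (SH a).
- exact: sum_of_mem SH HY.
Qed.

Lemma Hom_part_comp a b X Y :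
  Hom_part a X -> Hom_part b Y -> @Hom_part _ _ _ A (a + b) (X \o Y).
Proof.
move=> [linX degX] [linY degY]; split=> [k x y|c f Vf] /=; first by rewrite linY linX.
by rewrite -addrA; apply/degX/degY.
Qed.

Lemma Hom_part_commutator a b X Y :
  Hom_part a X -> Hom_part b Y -> Hom_part (a + b) (comm X Y).
Proof.
move=> HX HY; rewrite (endo_commutatorE HX HY).
have SH := Hom_part_subspace A (a + b).
apply: (subspaceD SH); first exact: Hom_part_comp.
by apply/(subspaceN SH)/(subspaceZ _ SH); rewrite addrC; apply: Hom_part_comp.
Qed.

Lemma endo_commutator_antisym a b X Y : Hom_part a X -> Hom_part b Y ->
  comm X Y = - (rho a b *: comm Y X).
Proof.
move=> HX HY; rewrite (endo_commutatorE HX HY) (endo_commutatorE HY HX).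
by rewrite scalerBr scalerA cocycle_sym// scale1r opprB.
Qed.

(** Both sides expand into words in [X], [Y], [Z]: the words [YXZ] and [ZXY] of
    the right-hand side cancel, and the four others match. *)
Lemma endo_commutator_jacobi a b c X Y Z :
    Hom_part a X -> Hom_part b Y -> Hom_part c Z ->
  comm X (comm Y Z) = comm (comm X Y) Z + rho a b *: comm Y (comm X Z).
Proof.
move=> HX HY HZ.
rewrite (endo_commutatorE HX (Hom_part_commutator HY HZ)).
rewrite (endo_commutatorE (Hom_part_commutator HX HY) HZ).
rewrite (endo_commutatorE HY (Hom_part_commutator HX HZ)).
rewrite (endo_commutatorE HX HY) (endo_commutatorE HX HZ) (endo_commutatorE HY HZ).
rewrite (cocycle_addl hrho) !(cocycle_addr hrho); apply/funext => f.
rewrite [LHS](_ : _ = X (Y (Z f) - rho b c *: Z (Y f))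
  - rho a b * rho a c *: (Y (Z (X f)) - rho b c *: Z (Y (X f))))//.
rewrite [RHS](_ : _ = X (Y (Z f)) - rho a b *: Y (X (Z f))
   - rho a c * rho b c *: Z (X (Y f) - rho a b *: Y (X f))
   + rho a b *: (Y (X (Z f) - rho a c *: Z (X f))
                 - rho b a * rho b c *: (X (Z (Y f)) - rho a c *: Z (X (Y f)))))//.
rewrite !(linear_eqB _ _ HX.1) !(linear_eqB _ _ HY.1) !(linear_eqB _ _ HZ.1).
rewrite !(linear_eqZ _ _ HX.1) !(linear_eqZ _ _ HY.1) !(linear_eqZ _ _ HZ.1).
rewrite !(scalerBr, scalerA) !opprB !mulrA cocycle_sym// mul1r.
(* The two parenthesized pairs of the reordering are the words that cancel. *)
rewrite !(addrA, opprD, opprK) [RHS](ACl (1 * 8 * 3 * 6 * (5 * 2) * (7 * 4)))%AC/=.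
rewrite subrr addr0 (mulrC (rho b c)) subrr addr0.
by rewrite (mulrC _ (rho a b)) !mulrA.
Qed.

End Commutators.

(** * Derivations of negative weight *)

Section Derivations.
Context {K : numFieldType} {G : zmodType} {rho : G -> G -> K}.
Context (hrho : cocycle rho).
Context (A : acAlgebra rho).
Implicit Types (a b c : G) (f g : A) (X Y Z : A -> A) (k : K) (v w : int).

Local Notation comm := (@endo_commutator _ _ rho A).
Local Notation "f ** g" := (ac_mul A f g) (at level 40, left associativity).

Lemma rhoDer_subspace a : subspace (@rhoDer _ _ _ A a).
Proof.
have [H0 HP] := Hom_part_subspace A a; split.
  split=> // b f g _.
  by rewrite [RHS](_ : _ = 0 ** g + rho a b *: (f ** 0))// linear0l linear0r scaler0 addr0.
move=> k X Y [HX derX] [HY derY]; split; first exact: HP.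
move=> b f g Vf.
rewrite [LHS](_ : _ = k *: X (f ** g) + Y (f ** g))//.
rewrite [RHS](_ : _ = (k *: X f + Y f) ** g + rho a b *: (f ** (k *: X g + Y g)))//.
rewrite (derX b)// (derY b)// linearPl linearPr !scalerDr !scalerA (mulrC k) !addrA.
by rewrite (ACl (1 * 3 * 2 * 4))%AC.
Qed.

(** The mixed terms [Yf Xg] and [Xf Yg] cancel, the latter because
    [rho a b * rho b a = 1]. *)
Lemma rhoDer_commutator a b X Y :
  rhoDer a X -> rhoDer b Y -> rhoDer (a + b) (comm X Y).
Proof.
move=> [HX derX] [HY derY]; split; first exact: Hom_part_commutator.
move=> c f g Vf; rewrite (endo_commutatorE HX HY).
rewrite [LHS](_ : _ = X (Y (f ** g)) - rho a b *: Y (X (f ** g)))//.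
rewrite [RHS](_ : _ = (X (Y f) - rho a b *: Y (X f)) ** g
  + rho (a + b) c *: (f ** (X (Y g) - rho a b *: Y (X g))))//.
rewrite (derY c)// (derX c)//.
rewrite !(linear_eqD _ _ HX.1) !(linear_eqD _ _ HY.1).
rewrite !(linear_eqZ _ _ HX.1) !(linear_eqZ _ _ HY.1).
rewrite (derX (b + c)); last exact: HY.2.
rewrite (derX c)// (derY (a + c)); last exact: HX.2.
rewrite (derY c)// (cocycle_addl hrho) !(cocycle_addr hrho).
rewrite linearBl linearBr linearZl_LR linearZr_LR.
rewrite !(scalerDr, scalerBr, scalerA) !(addrA, opprD).
rewrite [LHS](ACl (1 * 5 * 4 * 8 * (2 * 7) * (3 * 6)))%AC/=.
rewrite mulrA (cocycle_sym hrho) mul1r.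
rewrite !subrr !addr0 scalerN scalerA (mulrC (rho b c)).
by rewrite [rho a c * rho b c * rho a b]mulrC mulrA.
Qed.

(** A derivation that kills [g] is right linear over it, so its kernel is closed
    under multiplication although the Leibniz rule is stated only for
    homogeneous left factors. *)
Lemma rhoDer_kernel a X : rhoDer a X -> subalgebra [set f | X f = 0].
Proof.
move=> [HX derX]; split; first exact: kernel_subspace HX.1.
move=> f g /= Xf Xg; suff -> : X (f ** g) = X f ** g by rewrite Xf linear0l.
move: f {Xf}.
apply: (ac_homogeneous_ind (S := [set f | X (f ** g) = X f ** g])) => [|b f Vf /=].
  split=> [|k f h /= Xf Xh].
    by rewrite /= linear0l (linear_eq0 HX.1) linear0l.
  by rewrite linearPl !HX.1 linearPl Xf Xh.
by rewrite (derX b)// Xg linear0r scaler0 addr0.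
Qed.

Lemma rhoDer_weight_subspace w a : subspace (@rhoDer_weight _ _ _ A w a).
Proof.
have [D0 DP] := rhoDer_subspace a; split.
  by split=> // i f _; case: (weight_partZ_subspace A (w + i%:Z)).
move=> k X Y [DX wX] [DY wY]; split; first exact: DP.
move=> i f Vf; have [_ WP] := weight_partZ_subspace A (w + i%:Z).
by apply: WP; [apply: wX | apply: wY].
Qed.

Let weight_shift v w a X f :
  rhoDer_weight v a X -> weight_partZ w f -> weight_partZ (v + w) (X f).
Proof.
move=> [[[linX _] _] wX]; case: w => [i|n]; first exact: wX.
by move=> /= ->; rewrite (linear_eq0 linX); case: (weight_partZ_subspace A (v + Negz n)).
Qed.

Lemma rhoDer_weight_commutator v w a b X Y :
  rhoDer_weight v a X -> rhoDer_weight w b Y ->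
  rhoDer_weight (v + w) (a + b) (comm X Y).
Proof.
move=> DX DY; have [[DX1 _] [DY1 _]] := (DX, DY).
split; first exact: rhoDer_commutator.
move=> i f Vf; rewrite (endo_commutatorE DX1.1 DY1.1).
have SW := weight_partZ_subspace A (v + w + i%:Z).
apply: (subspaceD SW).
  by rewrite -addrA; apply: (weight_shift DX); apply: (weight_shift DY).
apply/(subspaceN SW)/(subspaceZ _ SW).
by rewrite (addrC v) -addrA; apply: (weight_shift DY); apply: (weight_shift DX).
Qed.

Lemma Alg_subalgebra (i : nat) : subalgebra (@Alg _ _ _ A i).
Proof.
split.
  split=> [B [[[B0 _] _] _]//|k f g Af Ag B BP].
  by case: (BP) => -[[_ BL] _] _; apply: BL; [apply: Af | apply: Ag].
move=> f g Af Ag B BP.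
by case: (BP) => -[_ BM] _; apply: BM; [apply: Af | apply: Ag].
Qed.

(** Strong induction on the weight: an element of weight [i > 1] is a polynomial
    in elements of smaller weight. *)
Lemma Alg1_full : generated_by_weight A 1 -> forall f, Alg 1 f.
Proof.
move=> gen f; have [S1 _] := Alg_subalgebra 1.
apply: (sum_of_min S1) (sum_weight_part f) => i; elim/ltn_ind: i => i IHi.
have [i1|i1] := leqP i 1.
  by move=> g Vg B [_ subB]; apply: subB; exists i.
rewrite (gen _ i1) => g [+ _]; apply; split; first exact: Alg_subalgebra.
by move=> h [j /= ji Vh]; apply: (IHi j) => //; case: i i1 ji {IHi}.
Qed.

Context (gen1 : generated_by_weight A 1).

(** A weight of at most -2 sends the generators, of weight 0 and 1, to negative
    weights, and the kernel is a subalgebra. *)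
Lemma rhoDer_weight_below n a X : rhoDer_weight (Negz n.+1) a X -> X = 0.
Proof.
move=> [DX wX]; apply/funext => f.
have /(_ [set g | X g = 0]) := Alg1_full gen1 f; apply; split; first exact: rhoDer_kernel DX.
by move=> g [[|[|//]] _ Vg]; exact: (wX _ _ Vg).
Qed.

Lemma SecE a : @Sec _ _ _ A a = rhoDer_weight (-1) a.
Proof.
apply/seteqP; split.
  apply: sum_of_min; first exact: rhoDer_weight_subspace.
  case=> [//|n] X /rhoDer_weight_below ->.
  by case: (rhoDer_weight_subspace (-1) a).
move=> X DX.
apply: (sum_of_mem (V := fun n : nat => rhoDer_weight (Negz n) a) (i := 0%N)) => //.
by move=> n; apply: rhoDer_weight_subspace.
Qed.

Lemma Sec_Hom a X : Sec a X -> Hom_part a X.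
Proof. by rewrite SecE => -[[]]. Qed.

Lemma Sec_subspace a : subspace (@Sec _ _ _ A a).
Proof. by rewrite SecE; apply: rhoDer_weight_subspace. Qed.

Lemma Sec_graded : graded (@Sec _ _ _ A).
Proof.
by apply: (graded_sub (Hom_part_graded A)); [exact: Sec_subspace | exact: Sec_Hom].
Qed.

(** The commutator has weight -2. *)
Lemma Sec_commute a b X Y : Sec a X -> Sec b Y -> comm X Y = 0.
Proof.
by rewrite !SecE => DX DY; have := rhoDer_weight_commutator DX DY;
  exact: rhoDer_weight_below.
Qed.

End Derivations.

(** * The derived antibracket *)

Section DerivedAntibracket.
Context {K : numFieldType} {G : zmodType} {rho : G -> G -> K}.
Context (hrho : cocycle rho) (A : acAlgebra rho).
Context (q : G) (Q : A -> A) (hQ : Qalgebra_degree1 q Q).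
Implicit Types (a b d : G) (sigma psi omega : A -> A) (k : K).

Local Notation comm := (@endo_commutator _ _ rho A).
Local Notation bracket := (derived_antibracket q Q).

Let gen1 : generated_by_weight A 1. Proof. by case: hQ => -[]. Qed.
Let derQ : rhoDer_weight 1 q Q. Proof. by case: hQ. Qed.
Let HQ : Hom_part q Q. Proof. by case: derQ => -[]. Qed.
Let oddQ : rho q q = -1. Proof. by case: hQ => _ []. Qed.
Let Q2 : comm Q Q = 0. Proof. by case: hQ => _ []. Qed.

Let SecH a sigma : Sec a sigma -> Hom_part a sigma.
Proof. exact: Sec_Hom. Qed.

Let sumH sigma : sum_of (@Sec _ _ _ A) sigma -> sum_of (@Hom_part _ _ _ A) sigma.
Proof.
apply: sum_of_min; first by apply: sum_of_subspace => a; apply: Hom_part_subspace.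
by move=> a X /SecH; apply: sum_of_mem => b; apply: Hom_part_subspace.
Qed.

Let commQ a sigma : Sec a sigma -> Hom_part (a + q) (comm Q sigma).
Proof. by rewrite addrC => /SecH; apply: Hom_part_commutator. Qed.

Lemma derived_antibracketE a sigma psi : Sec a sigma ->
  bracket sigma psi = rho (a + q) q *: comm (comm Q sigma) psi.
Proof.
move=> Ss; pose F b tau := rho (b + q) q *: comm (comm Q tau) psi.
have F0 b : F b 0 = 0; last first.
  exact: (homogeneous_extensionE (Sec_graded gen1) F0 Ss).
rewrite /F.
by rewrite (endo_commutator0r HQ) endo_commutator0l scaler0.
Qed.

Lemma derived_antibracket_Sec a b sigma psi : Sec a sigma -> Sec b psi ->
  Sec (a + b + q) (bracket sigma psi).
Proof.
move=> Ss Sp; rewrite (derived_antibracketE _ Ss).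
apply: subspaceZ; first exact: Sec_subspace.
move: Ss Sp; rewrite !(SecE gen1) => Ds Dp.
rewrite [a + b + q]addrC addrA.
have := rhoDer_weight_commutator hrho (rhoDer_weight_commutator hrho derQ Ds) Dp.
by rewrite subrr add0r.
Qed.

(** Jacobi expands [comm Q (comm sigma psi)], which is zero because sections
    commute, into the two terms to be compared. *)
Lemma derived_antibracket_antisym a b sigma psi : Sec a sigma -> Sec b psi ->
  bracket sigma psi = - (rho (a + q) (b + q) *: bracket psi sigma).
Proof.
move=> Ss Sp; rewrite (derived_antibracketE _ Ss) (derived_antibracketE _ Sp).
have /eqP := endo_commutator_jacobi hrho HQ (SecH Ss) (SecH Sp).
rewrite (Sec_commute hrho gen1 Ss Sp) (endo_commutator0r HQ) eq_sym addr_eq0 => /eqP ->.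
rewrite (endo_commutator_antisym hrho (SecH Ss) (commQ Sp)).
rewrite !(scalerN, scalerA) opprK -scaleNr.
congr (_ *: _).
rewrite !(cocycle_addl hrho) !(cocycle_addr hrho) oddQ.
rewrite !(mulrN1, mulN1r, mulNr, mulrN, opprK).
rewrite (cocycle_sym hrho) mul1r -mulrA (cocycle_sym hrho) mulr1.
by [].
Qed.

(** [comm Q Q = 0] makes [comm Q] a differential because 2 is invertible. *)
Lemma homological_differential a X : Hom_part a X -> comm Q (comm Q X) = 0.
Proof.
move=> HX; have := endo_commutator_jacobi hrho HQ HQ HX.
rewrite Q2 endo_commutator0l add0r oddQ scaleN1r => /eqP.
by rewrite -addr_eq0 -mulr2n -scaler_nat scaler_eq0 pnatr_eq0 => /eqP.
Qed.

(** Up to a factor, [comm Q] takes the antibracket of two sections to the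
    commutator of their images. *)
Lemma comm_bracket_homological a b sigma psi : Sec a sigma -> Sec b psi ->
  comm Q (comm (comm Q sigma) psi)
    = rho q (a + q) *: comm (comm Q sigma) (comm Q psi).
Proof.
move=> Ss Sp; rewrite (endo_commutator_jacobi hrho HQ (commQ Ss) (SecH Sp)).
by rewrite (homological_differential (SecH Ss)) endo_commutator0l add0r.
Qed.

(** This is the Jacobi identity of the commutator for [comm Q sigma],
    [comm Q psi] and [omega]. *)
Lemma derived_antibracket_jacobi a b d sigma psi omega :
    Sec a sigma -> Sec b psi -> Sec d omega ->
  bracket sigma (bracket psi omega) = bracket (bracket sigma psi) omega
    + rho (a + q) (b + q) *: bracket psi (bracket sigma omega).
Proof.
move=> Ss Sp So; have [HQs HQp] := (commQ Ss, commQ Sp).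
rewrite (derived_antibracketE _ (derived_antibracket_Sec Ss Sp)).
rewrite !(derived_antibracketE _ Ss) !(derived_antibracketE _ Sp).
have Hsp := Hom_part_commutator HQs HQp.
rewrite (endo_commutatorZr _ HQ (Hom_part_commutator HQs (SecH Sp))).
rewrite (comm_bracket_homological Ss Sp) scalerA (endo_commutatorZl _ Hsp (SecH So)).
rewrite (endo_commutatorZr _ HQs (Hom_part_commutator HQp (SecH So))).
rewrite (endo_commutatorZr _ HQp (Hom_part_commutator HQs (SecH So))).
rewrite (endo_commutator_jacobi hrho HQs HQp (SecH So)) !scalerDr !scalerA.
congr (_ *: _ + _ *: _).
  rewrite (cocycle_sym hrho) mulr1 !(cocycle_addl hrho) oddQ.
  by rewrite !mulrN1 mulrNN opprK.
by rewrite mulrC [rho (a + q) q * _]mulrC mulrA.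
Qed.

Lemma derived_antibracket_linearl k sigma sigma' psi :
    sum_of (@Sec _ _ _ A) sigma -> sum_of (@Sec _ _ _ A) sigma' ->
    sum_of (@Sec _ _ _ A) psi ->
  bracket (k *: sigma + sigma') psi = k *: bracket sigma psi + bracket sigma' psi.
Proof.
move=> Ss Ss' Sp; pose F b tau := rho (b + q) q *: comm (comm Q tau) psi.
apply: (homogeneous_extension_linear (F := F) k (Sec_graded gen1)) Ss Ss'.
move=> b l tau tau' St St'; rewrite /F.
have Hb : forall b', subspace (@Hom_part _ _ _ A b') by exact: Hom_part_subspace.
rewrite (endo_commutator_linearr _ HQ (sum_of_mem Hb (SecH St)) (sum_of_mem Hb (SecH St'))).
rewrite (endo_commutator_linearl _ (commQ St) (commQ St') (sumH Sp)).
by rewrite scalerDr !scalerA mulrC.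
Qed.

Lemma derived_antibracket_linearr k sigma psi psi' :
    sum_of (@Sec _ _ _ A) sigma -> sum_of (@Sec _ _ _ A) psi ->
    sum_of (@Sec _ _ _ A) psi' ->
  bracket sigma (k *: psi + psi') = k *: bracket sigma psi + bracket sigma psi'.
Proof.
move=> Ss Sp Sp'; have gS := Sec_graded gen1.
have fin tau : finite_set [set a |
    rho (a + q) q *: comm (comm Q (component (@Sec _ _ _ A) a sigma)) tau != 0].
  have [_ + _] := sum_of_decomposes gS Ss; apply: sub_finite_set => a /=.
  apply: contra_neq => ->.
  by rewrite (endo_commutator0r HQ) endo_commutator0l scaler0.
rewrite /derived_antibracket -fsum_linear; [|exact: fin..].
apply: eq_fsbigr => a _.
rewrite (endo_commutator_linearr _ (commQ (component_mem a sigma gS)) (sumH Sp) (sumH Sp')).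
by rewrite scalerDr !scalerA mulrC.
Qed.

(** Bilinearity reduces the claim to homogeneous sections, one argument at a
    time. *)
Lemma derived_antibracket_closed sigma psi :
    sum_of (@Sec _ _ _ A) sigma -> sum_of (@Sec _ _ _ A) psi ->
  sum_of (@Sec _ _ _ A) (bracket sigma psi).
Proof.
move=> Ss Sp; have gS := Sec_graded gen1.
have SS := sum_of_subspace gS.1.
apply: (subspace_fsum SS) => a; have Sa := component_mem a sigma gS.
rewrite -(derived_antibracketE _ Sa); move: (component _ _ _) Sa => tau St.
have sumt : sum_of (@Sec _ _ _ A) tau by apply: sum_of_mem gS.1 St.
suff /(_ _ Sp)[] : sum_of (@Sec _ _ _ A) `<=`
  [set p | sum_of (@Sec _ _ _ A) p /\ sum_of (@Sec _ _ _ A) (bracket tau p)] by [].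
apply: sum_of_min => [|b p Sb]; last first.
  split; first exact: sum_of_mem gS.1 Sb.
  exact: sum_of_mem gS.1 (derived_antibracket_Sec St Sb).
have S0 : sum_of (@Sec _ _ _ A) 0 by case: SS.
split=> [|k u v [Su Sbu] [Sv Sbv]]; split=> //; last 2 first.
- by case: SS => _; apply.
- by rewrite derived_antibracket_linearr//; case: SS => _; apply.
have := derived_antibracket_linearr (-1) sumt S0 S0.
by rewrite scaler0 addr0 scaleN1r addNr => ->.
Qed.

End DerivedAntibracket.

Theorem theorem4p4 (R : realType) (c : scalar_choice) (G : zmodType)
    (rho : G -> G -> scalars R c) (hrho : cocycle rho)
    (A : acAlgebra rho) (q : G) (Q : A -> A) (hQ : Qalgebra_degree1 q Q) :
  [/\ forall (a b : G) (sigma psi : A -> A),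
        Sec a sigma -> Sec b psi ->
        Sec (a + b + q) (derived_antibracket q Q sigma psi),
      forall (a b : G) (sigma psi : A -> A),
        Sec a sigma -> Sec b psi ->
        derived_antibracket q Q sigma psi =
          - (rho (a + q) (b + q) *: derived_antibracket q Q psi sigma),
      forall (a b d : G) (sigma psi omega : A -> A),
        Sec a sigma -> Sec b psi -> Sec d omega ->
        derived_antibracket q Q sigma (derived_antibracket q Q psi omega) =
          derived_antibracket q Q (derived_antibracket q Q sigma psi) omega
          + rho (a + q) (b + q) *:
              derived_antibracket q Q psi (derived_antibracket q Q sigma omega)
    & rho_Lie_antialgebra rho q (@Sec _ _ _ A) (derived_antibracket q Q)].
Proof.
have gen1 : generated_by_weight A 1 by case: hQ => -[].
have deg a b sigma psi : Sec a sigma -> Sec b psi ->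
    Sec (a + b + q) (derived_antibracket q Q sigma psi).
  exact: derived_antibracket_Sec.
split=> //.
- by move=> a b sigma psi; apply: derived_antibracket_antisym.
- by move=> a b d sigma psi omega; apply: derived_antibracket_jacobi.
split.
- exact: Sec_graded gen1.
- by move=> k sigma sigma' psi; apply: derived_antibracket_linearl.
- by move=> k sigma psi psi'; apply: derived_antibracket_linearr.
- by move=> sigma psi; apply: derived_antibracket_closed.
- by case: hQ => _ [].
- by move=> a b sigma psi Ss Sp; rewrite -addrA addrC; apply: deg.
- by move=> a b d sigma psi omega; apply: derived_antibracket_jacobi.
- by move=> a b sigma psi; apply: derived_antibracket_antisym.
Qed.
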